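(* Fix $\beta>0$ and $m>1$. Let $B_{\beta,m}>0$ be a constant with the following property: for every $\rho\in\mathcal P(\Omega)$ with $\|\rho\|_{L^\infty(\Omega)}>B_{\beta,m}$ there exists $\bar\rho\in\mathcal P(\Omega)$ with $\|\bar\rho\|_{L^\infty(\Omega)}\le B_{\beta,m}$ and $\mathcal F_\beta^m(\bar\rho)<\mathcal F_\beta^m(\rho)$ (such a constant exists). Then $\mathcal F_\beta^m:\mathcal P(\Omega)\to(-\infty,+\infty]$ has a minimiser $\rho^*\in\mathcal P(\Omega)\cap L^\infty(\Omega)$. Additionally, $$\|\rho^*\|_{L^\infty(\Omega)}\le B_{\beta,m}.$$
   Context: $\Omega=\mathbb T^d$ is the torus of side length $L>0$; $\mathcal P(\Omega)$ is the set of Borel probability measures on $\Omega$, identified with their densities when these exist ($\|\rho\|_{L^\infty}=+\infty$ if $\rho$ has no bounded density). $W\in C^2(\Omega)$ is even along every coordinate and has mean zero. For $m>1$, $$\mathcal F_\beta^m(\rho)=\frac{\beta^{-1}}{m-1}\int_\Omega\rho^m\,dx-\frac{\beta^{-1}}{m-1}+\frac12\iint_{\Omega\times\Omega}W(x-y)\rho(x)\rho(y)\,dx\,dy$$ whenever these quantities are finite, and $+\infty$ otherwise. *)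

(* Defs.v *)
From HB Require Import structures.
From mathcomp Require Import all_boot all_order all_algebra.
From mathcomp Require Import all_classical all_reals all_analysis.

Set Implicit Arguments.
Unset Strict Implicit.
Unset Printing Implicit Defensive.

Import Order.TTheory GRing.Theory Num.Theory.
Import numFieldNormedType.Exports.

Local Open Scope classical_set_scope.
Local Open Scope charge_scope.
Local Open Scope ring_scope.

(* The torus T^d of side length L is represented by its fundamental domain
   [0, L[^d: its Borel sets are the Borel subsets of [0, L[^d, and a function
   on T^d is a function on R^d that is L-periodic in every coordinate. *)

Notation coords R d := (d.-tuple (measurableTypeR R)).

Section TorusMeasure.
Context {R : realType}.

Definition torus (d : nat) (L : R) : set (coords R d) :=
  [set x | forall i, (tnth x i : R) \in `[0, L[].

(* Membership in P(T^d): a Borel probability measure carried by [0, L[^d. *)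
Definition on_torus (d : nat) (L : R) (rho : probability (coords R d) R) :=
  rho (torus L) = 1%E.

Definition cons_point (d : nat) (p : measurableTypeR R * coords R d) :
  coords R d.+1 := [tuple of p.1 :: p.2].

Definition side_measure (L : R) : set (measurableTypeR R) -> \bar R :=
  mrestr (@lebesgue_measure R) (measurable_itv `[0, L[).

(* The Lebesgue measure dx of the torus, as the d-fold product of the Lebesgue
   measure on [0, L[. It does not charge the complement of [0, L[^d, so the
   integrals over all of R^d below are integrals over the torus. *)
Fixpoint torus_measure (d : nat) (L : R) : set (coords R d) -> \bar R :=
  match d with
  | 0 => \d_([tuple] : coords R 0)
  | d'.+1 =>
      pushforward (side_measure L \x @torus_measure d' L)%E (@cons_point d')
  end.

Lemma measurable_cons_point (d : nat) : measurable_fun setT (@cons_point d).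
Proof. exact: measurable_cons. Qed.

HB.instance Definition _ (L : R) := Measure.on (side_measure L).

Lemma side_measure_fin (L : R) : fin_num_fun (side_measure L).
Proof.
move=> A mA; rewrite ge0_fin_numE//.
have mI : measurable (`[0%R, L[%classic : set (measurableTypeR R)).
  exact: measurable_itv.
apply: (@le_lt_trans _ _ (lebesgue_measure (`[0%R, L[%classic : set R))).
  by rewrite /side_measure /mrestr le_measure ?inE//; exact: measurableI.
by rewrite lebesgue_measure_itv /=; case: ifP => _; rewrite ?ltry// -EFinB ltry.
Qed.

HB.instance Definition _ (L : R) :=
  Measure_isFinite.Build _ _ _ (side_measure L) (side_measure_fin L).

Lemma torus_measure_finite_measure (d : nat) (L : R) :
  exists m : {finite_measure set (coords R d) -> \bar R},
    torus_measure L = m :> (set (coords R d) -> \bar R).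
Proof.
elim: d => [|d [m IH]].
  by exists (\d_([tuple] : coords R 0) : {finite_measure set _ -> \bar R}).
have mc := @measurable_cons_point d.
pose M := measure_function_pushforward__canonical__measure_function_Measure
  (side_measure L \x m)%E mc.
have Mfin : fin_num_fun M.
  move=> A mA; rewrite ge0_fin_numE//; apply: (@le_lt_trans _ _ (M setT)).
    by rewrite le_measure ?inE.
  rewrite /M/= /pushforward preimage_setT -setXTT product_measure1E//.
  by rewrite lte_mul_pinfty// ?fin_num_measure// ltey_eq fin_num_measure.
pose F := Measure_isFinite.Build _ _ _ (M : set _ -> _) Mfin.
pose N : {finite_measure set (coords R d.+1) -> \bar R} :=
  HB.pack (Measure.sort M) (Measure.class M) F.
by exists N; rewrite /= IH.
Qed.

Lemma torus_measure0 (d : nat) (L : R) : @torus_measure d L set0 = 0%E.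
Proof. by have [m ->] := torus_measure_finite_measure d L; rewrite measure0. Qed.

Lemma torus_measure_ge0 (d : nat) (L : R) A : (0 <= @torus_measure d L A)%E.
Proof. by have [m ->] := torus_measure_finite_measure d L. Qed.

Lemma torus_measure_sigma_additive (d : nat) (L : R) :
  semi_sigma_additive (@torus_measure d L).
Proof.
have [m ->] := torus_measure_finite_measure d L.
exact: measure_semi_sigma_additive.
Qed.

HB.instance Definition _ (d : nat) (L : R) := isMeasure.Build _ _ _
  (@torus_measure d L) (torus_measure0 d L) (@torus_measure_ge0 d L)
  (@torus_measure_sigma_additive d L).

Lemma torus_measure_fin (d : nat) (L : R) : fin_num_fun (@torus_measure d L).
Proof.
by have [m ->] := torus_measure_finite_measure d L; exact: fin_num_measure.
Qed.

HB.instance Definition _ (d : nat) (L : R) := Measure_isFinite.Build _ _ _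
  (@torus_measure d L) (@torus_measure_fin d L).

End TorusMeasure.

Section Potential.
Context {R : realType} (d : nat).
Implicit Types (L : R) (W : 'rV[R]_d -> R).

Definition C2 W : Prop :=
  continuous W /\
  forall i : 'I_d, let DiW := 'D_(delta_mx 0 i) W in
    [/\ forall x, derivable W x (delta_mx 0 i),
        continuous DiW &
        forall j : 'I_d,
          (forall x, derivable DiW x (delta_mx 0 j)) /\
          continuous ('D_(delta_mx 0 j) DiW)].

Definition torus_periodic L W :=
  forall i : 'I_d, periodic W (L *: delta_mx 0 i).

Definition coordinate_even W :=
  forall (i : 'I_d) (x : 'rV[R]_d),
    W (\row_j if j == i then - x 0 j else x 0 j) = W x.

Definition to_row (x : coords R d) : 'rV[R]_d := \row_j tnth x j.

Definition mean_zero L W := \int[torus_measure L]_x W (to_row x) = 0.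

End Potential.

Section FreeEnergy.
Context {R : realType} (d : nat).
Variables (L : R) (rho : probability (coords R d) R).

Local Notation mu := (@torus_measure R d L).

(* Meaningful only when rho is dominated by mu; the Radon-Nikodym derivative is
   then finite everywhere, so that fine loses nothing. *)
Definition density (x : coords R d) : R :=
  fine (('d (charge_of_finite_measure rho) '/d mu) x).

(* A probability measure without density has infinite norm; for one with an
   unbounded density the essential supremum is already +oo. *)
Definition Linfty_norm : \bar R :=
  if `[< rho `<< mu >] then Lnorm mu +oo%E (EFin \o density) else +oo%E.

Variables (beta m : R) (W : 'rV[R]_d -> R).

Definition interaction (z : coords R d * coords R d) : R :=
  W (to_row z.1 - to_row z.2) * density z.1 * density z.2.

Definition finite_energy :=
  [/\ rho `<< mu,
      mu.-integrable setT (EFin \o (fun x => density x `^ m)) &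
      (mu \x mu)%E.-integrable setT (EFin \o interaction)].

Definition free_energy : \bar R :=
  if `[< finite_energy >] then
    (beta^-1 / (m - 1) * (\int[mu]_x (density x `^ m)) - beta^-1 / (m - 1)
     + 2^-1 * (\int[(mu \x mu)%E]_z interaction z))%:E
  else +oo%E.

End FreeEnergy.

Definition Linfty_reducing (R : realType) (d : nat) (L beta m : R)
    (W : 'rV[R]_d -> R) (B : R) :=
  forall rho : probability (coords R d) R,
    on_torus L rho -> (B%:E < Linfty_norm L rho)%E ->
    exists rho' : probability (coords R d) R,
      [/\ on_torus L rho', (Linfty_norm L rho' <= B%:E)%E &
          (free_energy L rho' beta m W < free_energy L rho beta m W)%E].

(* Main.v *)
From HB Require Import structures.
Require Import Defs.
From mathcomp Require Import all_boot all_order all_algebra.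
From mathcomp Require Import all_classical all_reals all_analysis.
From mathcomp Require Import measurable_realfun ess_sup_inf ring lra.

Import Order.TTheory GRing.Theory Num.Theory.
Import numFieldNormedType.Exports.

Local Open Scope classical_set_scope.
Local Open Scope ring_scope.

(** The densities bounded by a constant [B] form a compact set for weak
    convergence, on which the free energy is bounded below and lower
    semicontinuous; this gives a minimiser among them, and the reducing property
    of [B] makes it a minimiser among all probability measures.

    Compactness is obtained without functional analysis.  Along an ultrafilter
    every bounded real family converges, so for a minimising sequence of
    densities [h_n] the integrals over any measurable set [A] have a limit
    [phi A].  This set function is additive and at most [B mu(A)], which forces
    it to be countably additive, and its Radon-Nikodym derivative [f] again lies
    between [0] and [B].  By density of simple functions in L^1, the integrals
    of [g h_n] tend to the integral of [g f] for every integrable [g]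
    ([weak_limit]).

    The interaction energy is continuous for this convergence: the same
    construction applied to [h_n (x) h_n] on the product space yields a measure
    that agrees with [f (x) f] on rectangles, hence everywhere
    ([weak_limit_tensor]).  The internal energy is lower semicontinuous
    because a power lies above its tangents: the integral of [h_n^m] is at least
    that of [f^m + m f^(m-1) (h_n - f)], whose limit is the integral of [f^m]
    ([energy_minimiser]).

    That a reducing constant exists is a truncation argument
    ([truncation_lowers_energy]).  Cut a density [f] at a high level [M] and
    spread the excess mass [delta] evenly over the set where [f] is at most
    twice its mean, which fills at least half of the space.  By the tangent
    inequality the internal energy falls by at least a constant times
    [delta M^(m-1)], less a term linear in [delta] whose constant does not
    involve [M], while the interaction changes by at most a constant times
    [delta]; so a large enough [M] gives a strict decrease for every [f] of
    finite energy that exceeds [M] on a set of positive measure.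

    All this is done on an abstract finite measure space.  The rest identifies
    probability measures with densities up to null sets and checks that
    [(x, y) |-> W (x - y)] is bounded, by periodicity and compactness of a
    period cell, and measurable. *)

(** * Integrals of real-valued functions *)

Section real_integrals.
Context {disp : measure_display} {T : measurableType disp} {R : realType}.

Lemma integrable_fsub (mu : {measure set T -> \bar R}) (D : set T)
    (f g : T -> R) : measurable D ->
  mu.-integrable D (EFin \o f) -> mu.-integrable D (EFin \o g) ->
  mu.-integrable D (EFin \o (fun x => f x - g x)).
Proof. by move=> mD iF ig; exact: (@integrableB _ _ _ mu D mD _ _ iF ig). Qed.

Lemma integrable_fadd (mu : {measure set T -> \bar R}) (D : set T)
    (f g : T -> R) : measurable D ->
  mu.-integrable D (EFin \o f) -> mu.-integrable D (EFin \o g) ->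
  mu.-integrable D (EFin \o (fun x => f x + g x)).
Proof. by move=> mD iF ig; exact: (@integrableD _ _ _ mu D mD _ _ iF ig). Qed.

Lemma integrable_fscale (mu : {measure set T -> \bar R}) (D : set T)
    (c : R) (f : T -> R) : measurable D ->
  mu.-integrable D (EFin \o f) -> mu.-integrable D (EFin \o (fun x => c * f x)).
Proof. by move=> mD iF; exact: (@integrableZl _ _ _ mu D mD c _ iF). Qed.

Lemma integrable_mul_bounded (mu : {measure set T -> \bar R}) (D : set T)
    (g h : T -> R) (C : R) :
  measurable D -> mu.-integrable D (EFin \o g) -> measurable_fun D h ->
  (forall x, D x -> `|h x| <= C) ->
  mu.-integrable D (EFin \o (fun x => g x * h x)).
Proof.
move=> mD ig mh hC.
have mg : measurable_fun D g by apply/measurable_EFinP; exact: measurable_int ig.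
apply: (@le_integrable _ _ _ mu D mD _ (EFin \o (fun x => C * g x))).
- by apply/measurable_EFinP; exact: measurable_funM.
- move=> x Dx /=; rewrite lee_fin !normrM mulrC ler_wpM2r//.
  exact: le_trans (hC x Dx) (ler_norm _).
- exact: integrable_fscale.
Qed.

Lemma Rintegral_indicM (mu : {measure set T -> \bar R}) (A : set T) (k : T -> R) :
  \int[mu]_x (\1_A x * k x) = \int[mu]_(x in A) k x.
Proof.
rewrite [RHS]Rintegral_mkcond; apply: eq_Rintegral => x _.
by rewrite patchE indicE; case: (x \in A); rewrite ?mul1r ?mul0r.
Qed.

Variable mu : {finite_measure set T -> \bar R}.

Lemma integrable_bounded (D : set T) (h : T -> R) (C : R) :
  measurable D -> measurable_fun D h -> (forall x, D x -> `|h x| <= C) ->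
  mu.-integrable D (EFin \o h).
Proof.
move=> mD mh hC.
have := @integrable_mul_bounded mu D (cst 1) h C mD
  (finite_measure_integrable_cst mu 1 mD) mh hC.
by under [X in integrable _ _ X]eq_fun do rewrite /= mul1r.
Qed.

End real_integrals.

Lemma Rintegral_indic {disp : measure_display} {T : measurableType disp}
    {R : realType} (mu : {measure set T -> \bar R}) (A : set T) :
  measurable A -> \int[mu]_x \1_A x = fine (mu A).
Proof.
move=> mA; rewrite -[RHS]mul1r -Rintegral_cst// -[RHS]Rintegral_indicM.
by apply: eq_Rintegral => x _; rewrite mulr1.
Qed.

Lemma integrable_ae_eq {disp : measure_display} {T : measurableType disp}
    {R : realType} (mu : {measure set T -> \bar R}) (f g : T -> \bar R) :
  measurable_fun setT g -> ae_eq mu setT f g ->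
  mu.-integrable setT f -> mu.-integrable setT g.
Proof.
move=> mg fg /integrableP[mf fi]; apply/integrableP; split => //.
rewrite (ae_eq_integral (abse \o f))//; last by apply: filterS fg => x /= fgx _; rewrite fgx.
- exact: measurableT_comp.
- exact: measurableT_comp.
Qed.

(** * Limits of bounded densities along an ultrafilter *)

(** A cluster point of the family exists by compactness; an ultrafilter converges
    to each of its cluster points. *)
Lemma cvg_ultra_itv {R : realType} {I : Type} (U : set_system I)
    (FU : UltraFilter U) (u : I -> R) (a b : R) :
  (forall i, a <= u i <= b) -> cvg (u @ U).
Proof.
move=> uab.
have Uab : (u @ U) `[a, b]%classic by apply: nearW => i; rewrite /= in_itv/=.
have [p [_ clp]] := @segment_compact _ a b (u @ U) _ Uab.
apply/cvg_ex; exists p => V Vp.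
have [//|UV] := in_ultra_setVsetC (u @^-1` V) FU.
by have [x []] := clp (~` V) V UV Vp.
Qed.

Section additive_density.
Context {disp : measure_display} {T : measurableType disp} {R : realType}.
Variable mu : {finite_measure set T -> \bar R}.

(** Peels off one set at a time; applied below both to a set function and to
    the measure that bounds it. *)
Lemma finitely_additive_tail (phi : set T -> R) (F : (set T)^nat) (n : nat) :
  (forall A B, measurable A -> measurable B -> A `&` B = set0 ->
    phi (A `|` B) = phi A + phi B) ->
  (forall k, measurable (F k)) -> trivIset setT F ->
  phi (\bigcup_k F k) =
  \sum_(0 <= k < n) phi (F k) + phi (\bigcup_(k in [set k | (n <= k)%N]) F k).
Proof.
move=> addphi mF tF; elim: n => [|n IH].
  by rewrite big_nil add0r; congr phi; apply: eq_bigcupl; split => k.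
rewrite big_nat_recr//= -addrA -addphi; last 3 first.
- exact: mF.
- by apply: bigcup_measurable => k _.
- rewrite -subset0 => x [Fn [k /= nk Fk]].
  have /(_ _)/eqP := tF n k I I.
  by rewrite ltn_eqF// => /(_ (ex_intro _ x (conj Fn Fk))).
rewrite IH; congr (_ + phi _); apply/seteqP; split=> x.
  move=> [k /= nk Fk]; have [->|kn] := eqVneq n k; first by left.
  by right; exists k => //=; rewrite ltn_neqAle kn.
by move=> [Fn|[k /= nk Fk]]; [exists n => /=|exists k => //=; exact: ltnW].
Qed.

(** Domination by [B mu] turns finite additivity into countable additivity: the
    error after [n] terms is the value on the tail of the union, at most [B]
    times the measure of that tail, which vanishes in the limit. *)
Lemma density_of_bounded_additive (phi : set T -> R) (B : R) : 0 <= B ->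
  (forall A A', measurable A -> measurable A' -> A `&` A' = set0 ->
    phi (A `|` A') = phi A + phi A') ->
  (forall A, measurable A -> 0 <= phi A <= B * fine (mu A)) ->
  exists f : T -> R, [/\ measurable_fun setT f, (forall x, 0 <= f x <= B) &
    forall A, measurable A -> \int[mu]_(x in A) f x = phi A].
Proof.
move=> B0 addphi phiB.
pose nu A := if `[< measurable A >] then (phi A)%:E else 0%E.
have nuE A : measurable A -> nu A = (phi A)%:E by move=> mA; rewrite /nu asboolT.
have nu0 : nu set0 = 0%E.
  rewrite nuE//; congr EFin; have := addphi _ _ (@measurable0 _ T) measurable0.
  by rewrite setI0 setU0 => /(_ erefl); lra.
have nu_ge0 A : (0 <= nu A)%E.
  rewrite /nu; case: ifPn => // /asboolP mA.
  by rewrite lee_fin; have /andP[] := phiB A mA.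
have nu_sadd : semi_sigma_additive nu.
  move=> F mF tF mUF; rewrite nuE//.
  rewrite (_ : (fun n => _) = EFin \o (fun n => \sum_(0 <= k < n) phi (F k))); last first.
    by apply/funext => n /=; rewrite -sumEFin; apply: eq_bigr => k _; rewrite nuE.
  apply/fine_cvgP; split; first exact: nearW.
  have mtail n : measurable (\bigcup_(k in [set k | (n <= k)%N]) F k).
    by apply: bigcup_measurable => k _.
  have muadd A A' : measurable A -> measurable A' -> A `&` A' = set0 ->
      fine (mu (A `|` A')) = fine (mu A) + fine (mu A').
    by move=> mA mA' AA'; rewrite measureU// fineD// fin_num_measure.
  have cmu : (fun n => \sum_(0 <= k < n) fine (mu (F k))) @ \oo -->
      fine (mu (\bigcup_k F k)).
    have : (fun n => \sum_(0 <= k < n) mu (F k))%E @ \oo -->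
        (fine (mu (\bigcup_k F k)))%:E.
      by rewrite fineK ?fin_num_measure//; exact: measure_semi_sigma_additive.
    move=> /fine_cvg; apply: cvg_trans; apply: near_eq_cvg; apply: nearW => n /=.
    by rewrite sum_fine// => k _; rewrite fin_num_measure.
  apply: (@squeeze_cvgr _ _ _ _
    (fun n => phi (\bigcup_k F k) - B * (fine (mu (\bigcup_k F k)) -
       \sum_(0 <= k < n) fine (mu (F k)))) (fun=> phi (\bigcup_k F k))).
  - apply: nearW => n; have /= := phiB _ (mtail n).
    have /= -> := finitely_additive_tail (fine \o mu) F n muadd mF tF.
    have -> := finitely_additive_tail phi F n addphi mF tF.
    set p := phi _; set q := fine _; set t := (X in B * (X + q - X)) => pq.
    rewrite (_ : t + q - t = q); last by ring.
    lra.
  - have c := cvgB (cvg_cst (phi (\bigcup_k F k))) (cvgM (cvg_cst B)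
      (cvgB (cvg_cst (fine (mu (\bigcup_k F k)))) cmu)).
    by move: c; rewrite subrr mulr0 subr0; exact.
  - exact: cvg_cst.
have [nuF nuFE] : exists nuF : {finite_measure set T -> \bar R},
    nuF = nu :> (set T -> \bar R).
  pose nuM : {measure set T -> \bar R} := HB.pack nu
    (isMeasure.Build _ _ _ nu nu0 nu_ge0 nu_sadd).
  have nufin : fin_num_fun nuM by move=> A mA; rewrite /= nuE.
  pose nuFin := Measure_isFinite.Build _ _ _ (nuM : set _ -> _) nufin.
  by exists (HB.pack_for {finite_measure set T -> \bar R}
    (Measure.sort nuM) (Measure.class nuM) nuFin).
have nu_mu : nuF `<< mu.
  apply/null_content_dominatesP => A mA A0; rewrite nuFE nuE//; congr EFin.
  have := phiB A mA; rewrite A0 /= mulr0; lra.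
have [g [g0 gfin ig gE]] := radon_nikodym_sigma_finite nu_mu.
have mg : measurable_fun setT g := measurable_int _ ig.
have gA A : measurable A -> (\int[mu]_(x in A) g x = (phi A)%:E)%E.
  by move=> mA; rewrite -gE// nuFE nuE.
pose f x := Num.min (fine (g x)) B.
have mf : measurable_fun setT f.
  by apply: measurable_minr => //; exact: measurableT_comp.
exists f; split => //.
  by move=> x; rewrite /f le_min ge_min lexx orbT B0 fine_ge0.
(* Capping [g] at [B] changes it on a null set only: on the set where it
   exceeds [B], the bound on [phi] forces its integrals to be those of [B]. *)
pose E := [set x | (B%:E < g x)%E].
have mE : measurable E.
  by rewrite -[E]setTI; exact: emeasurable_fun_o_infty.
have gB : ae_eq mu E g (cst B%:E).
  apply: integral_ae_eq => //.
  - exact: integrableS ig.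
  - move=> A AE mA; apply/eqP; rewrite eq_le; apply/andP; split.
      rewrite gA// integral_cst// -[X in (_ <= _ * X)%E]fineK ?fin_num_measure//.
      rewrite -EFinM lee_fin.
      by have /andP[] := phiB A mA.
    apply: ge0_le_integral => //.
      exact: measurable_funTS.
    by move=> x /AE/ltW.
have fg : \forall x \ae mu, (f x)%:E = g x.
  apply: filterS gB => x gB; rewrite /f; have [gxB|gxB] := leP (g x) B%:E.
    rewrite min_l ?fineK// -lee_fin fineK//.
  by rewrite gB// minxx.
move=> A mA; rewrite /Rintegral.
rewrite (ae_eq_integral g)//.
- by rewrite gA.
- by apply/measurable_EFinP; exact: measurable_funTS.
- exact: measurable_funTS.
- by apply: filterS fg => x ->.
Qed.

End additive_density.

Section weak_limit.
Context {disp : measure_display} {T : measurableType disp} {R : realType}.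
Variable mu : {finite_measure set T -> \bar R}.

(** The estimate is uniform over all [h] with values in [[0, B]], so that an L^1
    approximation of [g] passes through the limit along the family. *)
Lemma Rintegral_mul_dist (g g' h : T -> R) (B : R) :
  mu.-integrable setT (EFin \o g) -> mu.-integrable setT (EFin \o g') ->
  measurable_fun setT h -> (forall x, 0 <= h x <= B) ->
  `|\int[mu]_x (g x * h x) - \int[mu]_x (g' x * h x)| <=
    B * \int[mu]_x `|g x - g' x|.
Proof.
move=> ig ig' mh hB.
have hB' x : setT x -> `|h x| <= B.
  by move=> _; have /andP[h0 ?] := hB x; rewrite ger0_norm.
have igh := @integrable_mul_bounded _ _ _ _ _ _ _ _ measurableT ig mh hB'.
have igh' := @integrable_mul_bounded _ _ _ _ _ _ _ _ measurableT ig' mh hB'.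
have igg : mu.-integrable setT (EFin \o (fun x => `|g x - g' x|)).
  by apply: integrable_norm; exact: integrable_fsub.
rewrite -RintegralB//.
apply: (le_trans (le_normr_Rintegral measurableT _)); first exact: integrable_fsub.
rewrite -RintegralZl//; apply: le_Rintegral => //.
- by apply: integrable_norm; exact: integrable_fsub.
- exact: integrable_fscale.
- move=> x _; rewrite -mulrBl normrM mulrC ler_wpM2r//; exact: hB'.
Qed.

Import HBSimple.

Context {I : Type} (U : set_system I) (FU : UltraFilter U).

(** Weak compactness of the bounded densities: the ultrafilter plays the part of
    a convergent subsequence. *)
Lemma weak_limit (h : I -> T -> R) (B : R) : 0 <= B ->
  (forall i, measurable_fun setT (h i)) -> (forall i x, 0 <= h i x <= B) ->
  exists f : T -> R, [/\ measurable_fun setT f, (forall x, 0 <= f x <= B) &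
    forall g : T -> R, mu.-integrable setT (EFin \o g) ->
      \int[mu]_x (g x * h i x) @[i --> U] --> \int[mu]_x (g x * f x)].
Proof.
move=> B0 mh hB.
have ih i A : measurable A -> mu.-integrable A (EFin \o h i).
  move=> mA; apply: (@integrable_bounded _ _ _ mu A (h i) B) => //.
    exact: measurable_funTS.
  by move=> x _; have /andP[h0 ?] := hB i x; rewrite ger0_norm.
have NB i A : measurable A -> 0 <= \int[mu]_(x in A) h i x <= B * fine (mu A).
  move=> mA; rewrite Rintegral_ge0/=; last by move=> x _; have /andP[] := hB i x.
  rewrite -Rintegral_cst//; apply: le_Rintegral => //; first exact: ih.
    exact: (finite_measure_integrable_cst mu B mA).
  by move=> x _; have /andP[] := hB i x.
pose phi A := lim (\int[mu]_(x in A) h i x @[i --> U]).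
have phiP A : measurable A -> \int[mu]_(x in A) h i x @[i --> U] --> phi A.
  move=> mA; apply: (@cvg_ultra_itv _ _ _ _ (fun i => \int[mu]_(x in A) h i x)).
  by move=> i; exact: NB.
have [||f [mf fB fE]] := @density_of_bounded_additive _ _ _ mu phi B B0.
- move=> A A' mA mA' AA'; apply/cvg_lim => //.
  rewrite (_ : (fun i => _) =
    (fun i => \int[mu]_(x in A) h i x + \int[mu]_(x in A') h i x)).
    exact: cvgD (phiP _ mA) (phiP _ mA').
  apply/funext => i; rewrite Rintegral_setU//; last exact/disj_set2P.
  by apply: ih; exact: measurableU.
- move=> A mA; apply/andP; split.
    by apply: (cvgr_to_ge (phiP A mA)); apply: nearW => i; have /andP[] := NB i A mA.
  by apply: (cvgr_to_le (phiP A mA)); apply: nearW => i; have /andP[] := NB i A mA.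
exists f; split => //.
have cindic A : measurable A ->
    \int[mu]_x (\1_A x * h i x) @[i --> U] --> \int[mu]_x (\1_A x * f x).
  move=> mA; rewrite Rintegral_indicM fE//.
  rewrite (_ : (fun i => _) = (fun i => \int[mu]_(x in A) h i x)); first exact: phiP.
  by apply/funext => i; rewrite Rintegral_indicM.
have hB' i x : `|h i x| <= B.
  by have /andP[h0 ?] := hB i x; rewrite ger0_norm.
have fB' x : `|f x| <= B.
  by have /andP[f0 ?] := fB x; rewrite ger0_norm.
have csum (s : seq R) (A : R -> set T) : (forall y, measurable (A y)) ->
    mu.-integrable setT (EFin \o (fun x => \sum_(y <- s) y * \1_(A y) x)) /\
    \int[mu]_x ((\sum_(y <- s) y * \1_(A y) x) * h i x) @[i --> U] -->
    \int[mu]_x ((\sum_(y <- s) y * \1_(A y) x) * f x).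
  move=> mA; elim: s => [|y s [IHi IHc]].
    split; first by under eq_fun do rewrite big_nil; exact: integrable0.
    have E (k : T -> R) : \int[mu]_x ((\sum_(y <- [::]) y * \1_(A y) x) * k x) = 0.
      under eq_Rintegral do rewrite big_nil mul0r.
      by rewrite Rintegral_cst// mul0r.
    by rewrite E; under eq_fun do rewrite E; exact: cvg_cst.
  have i1 : mu.-integrable setT (EFin \o \1_(A y)) by exact: integrable_indic.
  have iy : mu.-integrable setT (EFin \o (fun x => y * \1_(A y) x)).
    exact: integrable_fscale.
  split.
    by under eq_fun do rewrite big_cons; exact: integrable_fadd.
  have E (k : T -> R) : measurable_fun setT k -> (forall x, `|k x| <= B) ->
    \int[mu]_x ((\sum_(z <- y :: s) z * \1_(A z) x) * k x) =
    y * \int[mu]_x (\1_(A y) x * k x) +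
    \int[mu]_x ((\sum_(z <- s) z * \1_(A z) x) * k x).
    move=> mk kB; under eq_Rintegral do rewrite big_cons mulrDl -mulrA.
    have ik := @integrable_mul_bounded _ _ _ mu _ _ _ _ measurableT i1 mk (fun x _ => kB x).
    rewrite RintegralD//; first by rewrite RintegralZl.
      exact: integrable_fscale.
    exact: (@integrable_mul_bounded _ _ _ mu _ _ _ _ measurableT IHi mk (fun x _ => kB x)).
  rewrite E// (_ : (fun i => _) = fun i => y * \int[mu]_x (\1_(A y) x * h i x) +
    \int[mu]_x ((\sum_(z <- s) z * \1_(A z) x) * h i x)); last first.
    by apply/funext => i; rewrite E.
  apply: cvgD => //; apply: cvgM; first exact: cvg_cst.
  exact: cindic.
move=> g ig.
have [s_ [is_ _ sg]] := approximation_sfun_integrable measurableT ig.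
apply/cvgrPdist_le => e e0.
(* [B + 1] rather than [B], which may be zero. *)
have e1 : 0 < e / (3 * (B + 1)) by rewrite divr_gt0// mulr_gt0// ltr_wpDl.
have [n dn] : exists n, \int[mu]_x `|g x - s_ n x| <= e / (3 * (B + 1)).
  move/fine_cvgP : sg => [_ /cvgrPdist_le /(_ _ e1)] [n _ /(_ n (leqnn n))] /=.
  rewrite sub0r normrN => h1; exists n; apply: le_trans h1.
  rewrite /Rintegral; under [X in fine X <= _]eq_integral do rewrite -abse_EFin EFinB.
  exact: ler_norm.
have smallB : B * \int[mu]_x `|g x - s_ n x| <= e / 3.
  apply: (le_trans (ler_wpM2l B0 dn)).
  have -> : e / 3 = (B + 1) * (e / (3 * (B + 1))).
    by field; rewrite gt_eqF// ltr_wpDl.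
  by rewrite ler_wpM2r ?lerDl// ltW.
pose r : seq R := finmap.enum_fset (fset_set (range (s_ n))).
have [_] := csum r (fun y => s_ n @^-1` [set y])
  (fun y => measurable_funPTI (s_ n) (measurable_set1 y)).
have sE (k : T -> R) : \int[mu]_x ((\sum_(y <- r)
    y * \1_(s_ n @^-1` [set y]) x) * k x) = \int[mu]_x (s_ n x * k x).
  by apply: eq_Rintegral => x _; rewrite [in RHS](fimfunE (s_ n)) fsbig_finite.
rewrite sE; under eq_fun do rewrite sE.
have e3 : 0 < e / 3 by lra.
move/cvgrPdist_le => /(_ _ e3); apply: filterS => i hi.
have d1 := @Rintegral_mul_dist g (s_ n) f B ig (is_ n) mf fB.
have d2 := @Rintegral_mul_dist g (s_ n) (h i) B ig (is_ n) (mh i) (hB i).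
by move: hi d1 d2 smallB; rewrite !ler_norml; set a := B * _; lra.
Qed.

End weak_limit.

(** * Densities on a product space *)

Section density_measure.
Context {disp : measure_display} {T : measurableType disp} {R : realType}.

Lemma density_measure (mu : {measure set T -> \bar R}) (f : T -> R) :
  measurable_fun setT f -> (forall x, 0 <= f x) ->
  exists nu : {measure set T -> \bar R},
    forall A, nu A = (\int[mu]_(x in A) (f x)%:E)%E.
Proof.
move=> mf f0; pose nu A := (\int[mu]_(x in A) (f x)%:E)%E.
have nu0 : nu set0 = 0%E by rewrite /nu integral_set0.
have nu_ge0 A : (0 <= nu A)%E by apply: integral_ge0 => x _; rewrite lee_fin.
have nu_sadd : semi_sigma_additive nu.
  apply: semi_sigma_additive_nng_induced; first exact/measurable_EFinP.
  by move=> x; rewrite lee_fin.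
by exists (HB.pack_for {measure set T -> \bar R} nu
  (isMeasure.Build _ _ _ nu nu0 nu_ge0 nu_sadd)).
Qed.

End density_measure.

Section product_density.
Context {disp : measure_display} {T : measurableType disp} {R : realType}.
Variable mu : {finite_measure set T -> \bar R}.

(** Bundles the product as a finite measure, so that [weak_limit] applies on the
    product space. *)
Lemma product_finite_measure : exists mu2 : {finite_measure set (T * T)%type -> \bar R},
  mu2 = (mu \x mu)%E :> (set (T * T)%type -> \bar R).
Proof.
pose M : {measure set (T * T)%type -> \bar R} := (mu \x mu)%E.
have Mfin : fin_num_fun M.
  move=> A mA; rewrite ge0_fin_numE//; apply: (@le_lt_trans _ _ (M setT)).
    by rewrite le_measure ?inE.
  rewrite /M /= -setXTT product_measure1E// lte_mul_pinfty// ?fin_num_measure//.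
  by rewrite ltey_eq fin_num_measure.
pose MFin := Measure_isFinite.Build _ _ _ (M : set _ -> _) Mfin.
by exists (HB.pack_for {finite_measure set (T * T)%type -> \bar R}
  (Measure.sort M) (Measure.class M) MFin).
Qed.

Lemma measurable_tensor (a b : T -> R) : measurable_fun setT a ->
  measurable_fun setT b -> measurable_fun setT (fun z : T * T => a z.1 * b z.2).
Proof.
move=> ma mb; apply: measurable_funM.
  exact: (measurableT_comp ma measurable_fst).
exact: (measurableT_comp mb measurable_snd).
Qed.

(** Tonelli for a product of functions of one variable each. *)
Lemma tensor_integral (a b : T -> R) :
  mu.-integrable setT (EFin \o a) -> mu.-integrable setT (EFin \o b) ->
  (forall x, 0 <= a x) -> (forall x, 0 <= b x) ->
  (mu \x mu)%E.-integrable setT (EFin \o (fun z => a z.1 * b z.2)) /\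
  \int[(mu \x mu)%E]_z (a z.1 * b z.2) = (\int[mu]_x a x) * (\int[mu]_x b x).
Proof.
move=> ia ib a0 b0.
have ma : measurable_fun setT a by apply/measurable_EFinP; exact: measurable_int ia.
have mb : measurable_fun setT b by apply/measurable_EFinP; exact: measurable_int ib.
have mab : measurable_fun setT (fun z : T * T => (a z.1 * b z.2)%:E).
  by apply/measurable_EFinP; exact: measurable_tensor.
have E : (\int[(mu \x mu)%E]_z (a z.1 * b z.2)%:E =
    (\int[mu]_x a x)%:E * (\int[mu]_x b x)%:E)%E.
  rewrite fubini_tonelli1//; last by move=> z; rewrite lee_fin mulr_ge0.
  rewrite /fubini_F /= /Rintegral !fineK ?integrable_fin_num//.
  have inner x : (\int[mu]_y (a x * b y)%:E = (a x)%:E * \int[mu]_y (b y)%:E)%E.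
    under eq_integral do rewrite EFinM; rewrite ge0_integralZl//.
    - exact/measurable_EFinP.
    - by move=> y _; rewrite lee_fin.
    - by rewrite lee_fin.
  rewrite [LHS](eq_integral (fun x => (a x)%:E * \int[mu]_y (b y)%:E)%E); last first.
    by move=> x _; exact: inner.
  rewrite ge0_integralZr//.
  - exact/measurable_EFinP.
  - by move=> y _; rewrite lee_fin.
  - by apply: integral_ge0 => y _; rewrite lee_fin.
split; last by rewrite /Rintegral E -EFinM.
apply/integrableP; split => //.
under eq_integral do rewrite /= ger0_norm ?mulr_ge0//.
by rewrite E -EFinM ltry.
Qed.

Context {J : Type} (U : set_system J) (FU : UltraFilter U).

(** The limit [k] of [h_i (x) h_i] comes from [weak_limit] on the product space.
    On rectangles its integrals are limits of products, hence those of [f (x) f],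
    and rectangles determine a finite measure; so [k] is [f (x) f] almost
    everywhere. *)
Lemma weak_limit_tensor (h : J -> T -> R) (f : T -> R) (B : R) : 0 <= B ->
  (forall i, measurable_fun setT (h i)) -> (forall i x, 0 <= h i x <= B) ->
  measurable_fun setT f -> (forall x, 0 <= f x <= B) ->
  (forall g : T -> R, mu.-integrable setT (EFin \o g) ->
    \int[mu]_x (g x * h i x) @[i --> U] --> \int[mu]_x (g x * f x)) ->
  forall G : T * T -> R, (mu \x mu)%E.-integrable setT (EFin \o G) ->
    \int[(mu \x mu)%E]_z (G z * (h i z.1 * h i z.2)) @[i --> U] -->
    \int[(mu \x mu)%E]_z (G z * (f z.1 * f z.2)).
Proof.
move=> B0 mh hB mf fB hf G iG.
have tB (k : T -> R) : (forall x, 0 <= k x <= B) ->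
    forall z : T * T, 0 <= k z.1 * k z.2 <= B * B.
  move=> kB z; have /andP[k10 k1B] := kB z.1; have /andP[k20 k2B] := kB z.2.
  by rewrite mulr_ge0//= ler_pM.
have [mu2 mu2E] := product_finite_measure.
have toM2 v : \int[(mu \x mu)%E]_z v z = \int[mu2]_z v z.
  by rewrite /Rintegral /= mu2E.
rewrite -mu2E in iG; rewrite toM2; under eq_fun do rewrite toM2.
have [||k [mk kB hk]] := @weak_limit _ _ _ mu2 _ U FU
  (fun i z => h i z.1 * h i z.2) (B * B) (mulr_ge0 B0 B0).
- by move=> i; exact: measurable_tensor.
- by move=> i; exact: tB.
have mff := measurable_tensor _ _ mf mf.
have ibd (A : set (T * T)%type) (v : T * T -> R) : measurable A -> measurable_fun setT v ->
    (forall z, 0 <= v z <= B * B) -> mu2.-integrable A (EFin \o v).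
  move=> mA mv vB; apply: (@integrable_bounded _ _ _ mu2 A v (B * B)) => //.
    exact: measurable_funTS.
  by move=> z _; have /andP[v0 ?] := vB z; rewrite ger0_norm.
have ibd1 (A : set T) (v : T -> R) : measurable A -> measurable_fun setT v ->
    (forall z, 0 <= v z <= B) -> mu.-integrable A (EFin \o v).
  move=> mA mv vB; apply: (@integrable_bounded _ _ _ mu A v B) => //.
    exact: measurable_funTS.
  by move=> z _; have /andP[v0 ?] := vB z; rewrite ger0_norm.
have [m1 m1E] := @density_measure _ _ _ mu2 k mk (fun z => proj1 (andP (kB z))).
have [m2 m2E] := @density_measure _ _ _ mu2 _ mff
  (fun z => proj1 (andP (tB f fB z))).
have rect (A A' : set T) (v : T -> R) : measurable A -> measurable A' ->
    measurable_fun setT v -> (forall x, 0 <= v x <= B) ->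
    \int[mu2]_z (\1_(A `*` A') z * (v z.1 * v z.2)) =
    (\int[mu]_x (\1_A x * v x)) * (\int[mu]_x (\1_A' x * v x)).
  move=> mA mA' mv vB.
  have iv (D : set T) : measurable D ->
      mu.-integrable setT (EFin \o (fun x => \1_D x * v x)).
    move=> mD; apply: ibd1 => //; first exact: measurable_funM.
    move=> x; have := vB x; rewrite indicE; case: (x \in D).
      by rewrite mul1r.
    by rewrite mul0r lexx.
  have v0 (D : set T) x : 0 <= \1_D x * v x.
    by rewrite mulr_ge0//; have /andP[] := vB x.
  have [_ <-] := tensor_integral _ _ (iv A mA) (iv A' mA') (v0 A) (v0 A').
  rewrite toM2; apply: eq_Rintegral => z _.
  rewrite !indicE in_setX; case: (z.1 \in A); case: (z.2 \in A');
    by rewrite ?mul1r ?mul0r ?mulr0.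
(* Rectangles are stable under intersection and generate the product. *)
have m12 C : measurable C -> m1 C = m2 C.
  apply: (measure_unique [set A `*` A' | A in measurable & A' in measurable]
    (fun=> setT)).
  - by rewrite measurable_prod_measurableType.
  - move=> _ _ [A mA [A' mA' <-]] [D mD [D' mD' <-]].
    exists (A `&` D); first exact: measurableI.
    by exists (A' `&` D'); [exact: measurableI|rewrite setXI].
  - by move=> _; exists setT => //; exists setT => //; rewrite setXTT.
  - by rewrite bigcup_const.
  - move=> _ [A mA [A' mA' <-]]; have mAA := measurableX mA mA'.
    suff eqR : \int[mu2]_(z in A `*` A') k z =
        \int[mu2]_(z in A `*` A') (f z.1 * f z.2).
      have fin (v : T * T -> R) : measurable_fun setT v -> (forall z, 0 <= v z <= B * B) ->
          (\int[mu2]_(z in A `*` A') (v z)%:E)%E \is a fin_num.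
        by move=> mv vB; apply: integrable_fin_num => //; exact: ibd.
      rewrite m1E m2E -(fineK (fin _ mk kB)) -(fineK (fin _ mff (tB f fB))).
      by congr EFin.
    transitivity (\int[mu2]_z (\1_(A `*` A') z * (f z.1 * f z.2))); last first.
      exact: Rintegral_indicM.
    rewrite -[LHS]Rintegral_indicM [RHS]rect//.
    apply: (@cvg_unique _ _ (fmap (fun i =>
      \int[mu2]_z (\1_(A `*` A') z * (h i z.1 * h i z.2))) U)) => //.
      by apply: hk; exact: integrable_indic.
    rewrite (_ : (fun i => _) = fun i =>
      (\int[mu]_x (\1_A x * h i x)) * (\int[mu]_x (\1_A' x * h i x))).
      by apply: cvgM; apply: hf; exact: integrable_indic.
    by apply/funext => i; exact: rect.
  - by move=> _; rewrite m1E; apply: integrable_lty => //; exact: ibd.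
have kff : ae_eq mu2 setT (EFin \o k) (EFin \o (fun z => f z.1 * f z.2)).
  apply: integral_ae_eq => //.
  - exact: ibd.
  - exact/measurable_EFinP.
  - by move=> C _ mC; rewrite -m1E -m2E m12.
suff -> : \int[mu2]_z (G z * (f z.1 * f z.2)) =
          \int[mu2]_z (G z * k z) by exact: hk.
have mG : measurable_fun setT G by apply/measurable_EFinP; exact: measurable_int iG.
congr fine; apply: ae_eq_integral => //.
- by apply/measurable_EFinP; exact: measurable_funM.
- by apply/measurable_EFinP; exact: measurable_funM.
- by apply: filterS kff => z /(_ I) /= [kz] _; rewrite kz.
Qed.

End product_density.

(** The exceptional set of each coordinate is a null set times the whole space. *)
Lemma ae_product {disp : measure_display} {T : measurableType disp}
    {R : realType} (mu : {finite_measure set T -> \bar R}) (P : T -> Prop) :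
  (\forall x \ae mu, P x) -> \forall z \ae (mu \x mu)%E, P z.1 /\ P z.2.
Proof.
move=> [N [mN N0 PN]].
have mNT := measurableX mN (@measurableT _ T).
have mTN := measurableX (@measurableT _ T) mN.
exists ((N `*` setT) `|` (setT `*` N)); split.
- exact: measurableU.
- apply/eqP; rewrite -measure_le0; apply: (le_trans (measureU2 _ mNT mTN)).
  have p1 : (mu \x mu)%E (N `*` setT) = 0%E.
    rewrite product_measure1E// [X in (X * _)%E](_ : _ = 0%E) ?mul0e//; exact: N0.
  have p2 : (mu \x mu)%E (setT `*` N) = 0%E.
    rewrite product_measure1E// [X in (_ * X)%E](_ : _ = 0%E) ?mule0//; exact: N0.
  by move: p1 p2 => /= -> ->; rewrite adde0.
- move=> z /= nP; have [Nz|/contrapT P1] := EM (~ P z.1).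
    by left; split => //; exact: PN.
  by right; split => //; apply: PN => /= P2; exact: nP.
Qed.

(** * Minimising the energy among bounded densities *)

(** Young's inequality for the exponents [m] and [m / (m - 1)], applied to [a]
    and [b^(m - 1)]. *)
Lemma powR_tangent {R : realType} (m a b : R) : 1 < m -> 0 <= a -> 0 <= b ->
  m * b `^ (m - 1) * (a - b) <= a `^ m - b `^ m.
Proof.
move=> m1 a0 b0; have m0 : 0 < m by lra.
have m10 : 0 < m - 1 by lra.
have := @conjugate_powR R a (b `^ (m - 1)) m (m / (m - 1)) a0 (powR_ge0 _ _) m0
  (divr_gt0 m0 m10).
have -> : (b `^ (m - 1)) `^ (m / (m - 1)) = b `^ m.
  by rewrite -powRrM; congr (_ `^ _); field; rewrite gt_eqF.
rewrite invf_div.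
have -> : m^-1 + (m - 1) / m = 1.
  by field; rewrite gt_eqF.
move=> /(_ erefl) young.
have -> : m * b `^ (m - 1) * (a - b) =
    m * (a * b `^ (m - 1)) - m * (b * b `^ (m - 1)) by ring.
rewrite mulr_powRB1//.
have -> : a `^ m - b `^ m =
    m * (a `^ m / m + b `^ m * ((m - 1) / m)) - m * b `^ m.
  by field; rewrite gt_eqF.
by rewrite lerD2r ler_wpM2l// ltW.
Qed.

Section energy.
Context {disp : measure_display} {T : measurableType disp} {R : realType}.
Variables (mu : {finite_measure set T -> \bar R}) (K : T * T -> R) (C c m : R).
Hypotheses (mK : measurable_fun setT K) (KC : forall z, `|K z| <= C).
Hypotheses (c0 : 0 <= c) (m1 : 1 < m).

Definition energy (f : T -> R) : R :=
  c * (\int[mu]_x (f x `^ m)) - c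
  + 2^-1 * (\int[(mu \x mu)%E]_z (K z * (f z.1 * f z.2))).

Definition bounded_density (B : R) : set (T -> R) :=
  [set f : T -> R | [/\ measurable_fun setT f, (forall x, 0 <= f x <= B) &
    \int[mu]_x f x = 1]].

Lemma bounded_integrable (B : R) (f : T -> R) : measurable_fun setT f ->
  (forall x, 0 <= f x <= B) -> mu.-integrable setT (EFin \o f).
Proof.
move=> mf fB; apply: (@integrable_bounded _ _ _ mu setT f B) => //.
by move=> x _; have /andP[f0 ?] := fB x; rewrite ger0_norm.
Qed.

Lemma kernel_integrable (k : T * T -> R) :
  (mu \x mu)%E.-integrable setT (EFin \o k) ->
  (mu \x mu)%E.-integrable setT (EFin \o (fun z => K z * k z)).
Proof.
move=> ik; under [X in integrable _ _ X]eq_fun do rewrite /= mulrC.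
exact: (integrable_mul_bounded _ _ _ _ _ measurableT ik mK (fun z _ => KC z)).
Qed.

Lemma bounded_kernel_integrable : (mu \x mu)%E.-integrable setT (EFin \o K).
Proof.
have [mu2 <-] := product_finite_measure mu.
exact: (integrable_bounded mu2 _ _ _ measurableT mK (fun z _ => KC z)).
Qed.

Lemma kernel_bound (k : T * T -> R) :
  (mu \x mu)%E.-integrable setT (EFin \o k) ->
  `|\int[(mu \x mu)%E]_z (K z * k z)| <= C * \int[(mu \x mu)%E]_z `|k z|.
Proof.
move=> ik; have iKk := kernel_integrable _ ik.
have inorm := integrable_norm ik.
apply: (le_trans (le_normr_Rintegral measurableT iKk)).
rewrite -RintegralZl//; apply: le_Rintegral => //.
- exact: integrable_norm.
- exact: integrable_fscale.
- by move=> z _; rewrite normrM ler_wpM2r.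
Qed.

(** The internal energy is nonnegative and the total mass of [f (x) f] is [1]. *)
Lemma energy_lower_bound (B : R) (f : T -> R) : bounded_density B f ->
  - c - 2^-1 * C <= energy f.
Proof.
move=> [mf fB f1]; have f0 x : 0 <= f x by have /andP[] := fB x.
have iF := bounded_integrable _ _ mf fB.
have [iff] := tensor_integral mu f f iF iF f0 f0; rewrite f1 mulr1 => ff1.
have := kernel_bound _ iff.
rewrite (_ : \int[(mu \x mu)%E]_z `|f z.1 * f z.2| = 1); last first.
  by rewrite -ff1; apply: eq_Rintegral => z _; rewrite ger0_norm// mulr_ge0.
have p0 : 0 <= \int[mu]_x (f x `^ m) by apply: Rintegral_ge0 => x _; exact: powR_ge0.
rewrite mulr1 ler_norml /energy => /andP[lo _].
have := mulr_ge0 c0 p0; lra.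
Qed.

Lemma powR_density (B p : R) (f : T -> R) : 0 <= p -> measurable_fun setT f ->
  (forall x, 0 <= f x <= B) ->
  measurable_fun setT (fun x => f x `^ p) /\ (forall x, 0 <= f x `^ p <= B `^ p).
Proof.
move=> p0 mf fB; split.
  exact: (measurableT_comp (measurable_powR p) mf).
move=> x; have /andP[f0 fxB] := fB x.
by rewrite powR_ge0/= ge0_ler_powR// nnegrE// (le_trans f0).
Qed.

(** A minimising sequence, its weak limit along an ultrafilter, and lower
    semicontinuity through the tangent of the power function at the limit. *)
Lemma energy_minimiser (B : R) : bounded_density B !=set0 ->
  exists2 f, bounded_density B f &
    forall g, bounded_density B g -> energy f <= energy g.
Proof.
move=> [g0 Bg0].
have B0 : 0 <= B.
  case: Bg0 => mg0 g0B g01; case: (lerP 0 B) => // Bn.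
  have := @Rintegral_ge0 _ _ _ mu setT (fun x => 0 - g0 x).
  have gneg x : 0 <= 0 - g0 x by have := g0B x; lra.
  rewrite RintegralB//.
  - rewrite Rintegral_cst// mul0r g01 => /(_ (fun x _ => gneg x)); lra.
  - exact: finite_measure_integrable_cst.
  - exact: bounded_integrable mg0 g0B.
pose A := [set energy f | f in bounded_density B].
have infA : has_inf A.
  split; first by exists (energy g0), g0.
  by exists (- c - 2^-1 * C) => _ [f Bf <-]; exact: energy_lower_bound Bf.
have /choice[h hP] (n : nat) : exists f, bounded_density B f /\
    energy f < inf A + n.+1%:R^-1.
  have [|_ [f Bf <-] fA] := @inf_adherent _ A n.+1%:R^-1 _ infA.
    by rewrite invr_gt0.
  by exists f.
have [U [FU ooU]] := @ultraFilterLemma nat \oo _.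
have mh n : measurable_fun setT (h n) by have [[]] := hP n.
have hB n x : 0 <= h n x <= B by have [[_ hB _] _] := hP n.
have [f [mf fB hf]] := @weak_limit _ _ _ mu _ U FU h B B0 mh hB.
have hff := weak_limit_tensor mu U FU h f B B0 mh hB mf fB hf.
have ione : mu.-integrable setT (EFin \o cst (1 : R)).
  exact: finite_measure_integrable_cst.
have f1 : \int[mu]_x f x = 1.
  have -> : \int[mu]_x f x = \int[mu]_x (cst 1 x * f x).
    by apply: eq_Rintegral => x _; rewrite /= mul1r.
  apply: (@cvg_unique _ _ (fmap (fun n => \int[mu]_x (cst 1 x * h n x)) U)) => //.
    exact: hf.
  rewrite (_ : (fun n => _) = fun=> 1); first exact: cvg_cst.
  apply/funext => n; have [[_ _ h1] _] := hP n; rewrite -[RHS]h1.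
  by apply: eq_Rintegral => x _; rewrite /= mul1r.
have Bf : bounded_density B f by [].
exists f => // g Bg.
apply: (@le_trans _ _ (inf A)); last first.
  by apply: ge_inf; [exact: infA.2|exists g].
have m0 : 0 <= m := ltW (lt_trans ltr01 m1).
have m10 : 0 <= m - 1 by rewrite subr_ge0 ltW.
have [mfp fpB] := powR_density _ _ _ m10 mf fB.
have [mfm fmB] := powR_density _ _ _ m0 mf fB.
have ifp := bounded_integrable _ _ mfp fpB.
have ifm := bounded_integrable _ _ mfm fmB.
(* A lower bound for the energy of [h n] that is affine in the power term,
   hence convergent; it tends to the energy of [f]. *)
pose lam n := c * (\int[mu]_x (f x `^ m) + m * (\int[mu]_x (f x `^ (m - 1) * h n x)
   - \int[mu]_x (f x `^ (m - 1) * f x))) - c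
  + 2^-1 * (\int[(mu \x mu)%E]_z (K z * (h n z.1 * h n z.2))).
have lamE : lam n @[n --> U] --> energy f.
  rewrite /energy -[X in c * X](addr0) -(mulr0 m).
  rewrite -[X in m * X](subrr (\int[mu]_x (f x `^ (m - 1) * f x))).
  apply: cvgD; last first.
    apply: cvgM; first exact: cvg_cst.
    by apply: hff; exact: bounded_kernel_integrable.
  apply: cvgB; last exact: cvg_cst.
  apply: cvgM; first exact: cvg_cst.
  apply: cvgD; first exact: cvg_cst.
  apply: cvgM; first exact: cvg_cst.
  apply: cvgB; last exact: cvg_cst.
  exact: hf.
have hA : energy (h n) @[n --> U] --> inf A.
  suff : energy (h n) @[n --> \oo] --> inf A by apply: cvg_trans; exact: cvg_app.
  have c1 : (inf A + n.+1%:R^-1) @[n --> \oo] --> inf A.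
    rewrite -[X in _ --> X]addr0.
    by apply: cvgD; [exact: cvg_cst|exact: cvg_harmonic].
  apply: (squeeze_cvgr _ _ c1); last exact: cvg_cst.
  apply: nearW => n; have [Bh /ltW ->] := hP n.
  by rewrite andbT; apply: ge_inf; [exact: infA.2|exists (h n)].
apply: (ler_cvg_to lamE hA); apply: nearW => n.
rewrite /lam /energy lerD2r lerD2r ler_wpM2l//.
have [mhm hmB] := powR_density _ _ _ m0 (mh n) (hB n).
have ihm := bounded_integrable _ _ mhm hmB.
have iph : mu.-integrable setT (EFin \o (fun x => f x `^ (m - 1) * h n x)).
  apply: (integrable_mul_bounded _ _ _ _ B measurableT ifp (mh n)) => x _.
  by have /andP[h0 ?] := hB n x; rewrite ger0_norm.
have ipf : mu.-integrable setT (EFin \o (fun x => f x `^ (m - 1) * f x)).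
  apply: (integrable_mul_bounded _ _ _ _ B measurableT ifp mf) => x _.
  by have /andP[h0 ?] := fB x; rewrite ger0_norm.
rewrite -RintegralB// -RintegralZl//; last exact: integrable_fsub.
rewrite -RintegralD//; last by apply: integrable_fscale => //; exact: integrable_fsub.
apply: le_Rintegral => //.
  apply: integrable_fadd => //.
  by apply: integrable_fscale => //; exact: integrable_fsub.
move=> x _; have /andP[h0 _] := hB n x; have /andP[f0 _] := fB x.
have := @powR_tangent _ m (h n x) (f x) m1 h0 f0.
rewrite -mulrBr mulrA; lra.
Qed.

End energy.

(** * Truncation lowers the energy *)

Section truncation.
Context {disp : measure_display} {T : measurableType disp} {R : realType}.
Variables (mu : {finite_measure set T -> \bar R}) (K : T * T -> R) (C c m : R).
Hypotheses (mK : measurable_fun setT K) (KC : forall z, `|K z| <= C).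
Hypotheses (c0 : 0 < c) (m1 : 1 < m).

Local Notation energy := (energy mu K c m).

(** One point of the truncation: [t] is the value of the density, [u] its excess
    over [M], and [b] tells whether the point belongs to the set that receives
    the added density [q].  The last bound is the tangent inequality at [g], whose slope
    is [m M^(m - 1)] where mass is removed and at most [m (2 a)^(m - 1)] where
    it is added. *)
Lemma redistributed_bounds (a M q t : R) (b : bool) :
  0 <= t -> 0 <= q <= a -> a + a <= M -> (b -> t <= a) ->
  let u := Num.max (t - M) 0 in let g := t - u + q * b%:R in
  [/\ 0 <= g <= M, `|t - g| <= u + q * b%:R &
      m * M `^ (m - 1) * u - m * (a + a) `^ (m - 1) * (q * b%:R)
        <= t `^ m - g `^ m].
Proof.
move=> t0 /andP[q0 qa] aM bt u g.
have gdef : g = t - u + q * b%:R by [].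
clearbody g; have m0 : 0 < m := lt_trans ltr01 m1.
have a0 : 0 <= a := le_trans q0 qa.
have M0 : 0 <= M by apply: le_trans aM; rewrite addr_ge0.
have uE : u = t - M /\ M <= t \/ u = 0 /\ t <= M.
  by rewrite /u; case: (lerP (t - M) 0) => h; [right|left]; split => //; lra.
have u0 : 0 <= u by rewrite /u le_max lexx orbT.
have [gE|] : g = t + q /\ u = 0 /\ g <= a + a /\ b \/ b = false /\ g = t - u.
  rewrite gdef; case: b bt {gdef} => bt; last by right; rewrite mulr0 addr0.
  left; have := bt isT => ta; case: uE => -[-> ?]; rewrite mulr1; split => //; lra.
- case: gE => gE [uz [ga bT]]; rewrite gE in ga *; rewrite bT mulr1 uz.
  have tg0 : 0 <= t + q by rewrite addr_ge0.
  have := @powR_tangent _ m t (t + q) m1 t0 tg0.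
  have : (t + q) `^ (m - 1) <= (a + a) `^ (m - 1).
    by rewrite ge0_ler_powR ?subr_ge0 ?nnegrE ?addr_ge0// ltW.
  have : 0 <= m * q by rewrite mulr_ge0// ltW.
  set X := _ `^ (m - 1); set Y := _ `^ (m - 1) => mq XY tan.
  split; first by rewrite tg0 (le_trans ga).
    rewrite opprD addNKr normrN ger0_norm; lra.
  rewrite mulr0 add0r; apply: le_trans tan.
  rewrite opprD addNKr mulrN lerN2.
  nra.
- move=> [bF gE]; rewrite bF mulr0 addr0 mulr0 subr0 gE.
  case: uE => -[uE tM].
    rewrite uE opprB addrC subrK M0 lexx; split => //.
      by rewrite ger0_norm// subr_ge0.
    exact: powR_tangent.
  by rewrite uE subr0 t0 tM subrr normr0 mulr0 subrr; split.
Qed.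

(** From [f f' - g g' = (f - g) f' + g (f' - g')], where the prime marks the
    second variable. *)
Lemma tensor_dist_integral (f g w : T -> R) :
  mu.-integrable setT (EFin \o f) -> mu.-integrable setT (EFin \o g) ->
  mu.-integrable setT (EFin \o w) ->
  (forall x, 0 <= f x) -> (forall x, 0 <= g x) ->
  (forall x, `|f x - g x| <= w x) ->
  \int[(mu \x mu)%E]_z `|f z.1 * f z.2 - g z.1 * g z.2| <=
    (\int[mu]_x w x) * (\int[mu]_x f x + \int[mu]_x g x).
Proof.
move=> iF ig iw f0 g0 fgw.
have w0 x : 0 <= w x by apply: le_trans (fgw x).
have [iff _] := tensor_integral mu f f iF iF f0 f0.
have [igg _] := tensor_integral mu g g ig ig g0 g0.
have [iwf wfE] := tensor_integral mu w f iw iF w0 f0.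
have [igw gwE] := tensor_integral mu g w ig iw g0 w0.
rewrite mulrDr -wfE [X in _ <= _ + X]mulrC -gwE -RintegralD//.
apply: le_Rintegral => //.
- by apply: integrable_norm; exact: integrable_fsub.
- exact: integrable_fadd.
- move=> z _; have -> : f z.1 * f z.2 - g z.1 * g z.2 =
      (f z.1 - g z.1) * f z.2 + g z.1 * (f z.2 - g z.2) by ring.
  apply: (le_trans (ler_normD _ _)); rewrite !normrM.
  by rewrite (ger0_norm (f0 _)) (ger0_norm (g0 _)) lerD// ?ler_wpM2r ?ler_wpM2l.
Qed.

Hypothesis muT : (0 < mu setT)%E.

(** The level [M] is chosen so that [M^(m - 1)] beats both the cost of the
    redistributed mass and the variation of the interaction energy. *)
Lemma truncation_lowers_energy :
  exists M : R, [/\ 0 < M, bounded_density mu M !=set0 &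
    forall f : T -> R, mu.-integrable setT (EFin \o f) -> (forall x, 0 <= f x) ->
    \int[mu]_x f x = 1 ->
    mu.-integrable setT (EFin \o (fun x => f x `^ m)) ->
    ~ (\forall x \ae mu, f x <= M) ->
    exists2 g, bounded_density mu M g & energy g < energy f].
Proof.
pose V := fine (mu setT).
have V0 : 0 < V by rewrite fine_gt0// muT ltey_eq fin_num_measure.
have m0 : 0 < m := lt_trans ltr01 m1.
have m10 : 0 < m - 1 by rewrite subr_gt0.
(* Twice the mean of a probability density. *)
pose a := 2 / V; have a0 : 0 < a by rewrite divr_gt0.
have aa0 : 0 < a + a by rewrite addr_gt0.
pose X := (a + a) `^ (m - 1).
have C0 : 0 <= C.
  have [z _] : (setT : set (T * T)) !=set0.
    apply: contrapT => /set0P/negP/negPn/eqP T0.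
    have : (mu setT = 0)%E.
      rewrite (_ : setT = set0) ?measure0//; apply/seteqP; split=> // x _.
      by have : (setT : set (T * T)) (x, x) by []; rewrite T0.
    by move=> muT0; move: muT; rewrite muT0 ltxx.
  exact: le_trans (KC z).
(* Lower bound required of [M^(m - 1)]: [X] pays for the added mass, the second
   term for the interaction, and [1] makes the decrease strict. *)
pose Y := X + 2 * C / (c * m) + 1.
have X0 : 0 <= X by exact: powR_ge0.
have cm0 : 0 < c * m by rewrite mulr_gt0.
have Y0 : 0 <= Y by rewrite !addr_ge0 ?divr_ge0 ?mulr_ge0// ltW.
pose M := Num.max (a + a) (Y `^ (m - 1)^-1).
have aM : a + a <= M by rewrite le_max lexx.
have YM : Y <= M `^ (m - 1).
  have -> : Y = (Y `^ (m - 1)^-1) `^ (m - 1).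
    by rewrite -powRrM mulVf ?powRr1// gt_eqF.
  by rewrite ge0_ler_powR ?nnegrE ?powR_ge0 ?(ltW m10)// /M ?le_max ?lexx ?orbT// (ltW aa0).
exists M; split; first exact: lt_le_trans aM.
  exists (cst V^-1); split => //.
    move=> x /=; rewrite invr_ge0 ltW//=; apply: le_trans aM.
    by rewrite -mulrDl ler_peMl ?invr_ge0 ?(ltW V0)//; lra.
  by rewrite Rintegral_cst// mulVf// gt_eqF.
move=> f iF f0 f1 ifm fM.
have mf : measurable_fun setT f by apply/measurable_EFinP; exact: measurable_int iF.
pose u x := Num.max (f x - M) 0.
have meas_u : measurable_fun setT u by apply: measurable_maxr => //; exact: measurable_funB.
have u0 x : 0 <= u x by rewrite /u le_max lexx orbT.
have uf x : u x <= f x.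
  rewrite /u ge_max f0 andbT; have : 0 < M by exact: lt_le_trans aM.
  lra.
have iu : mu.-integrable setT (EFin \o u).
  apply: le_integrable iF => //; first exact/measurable_EFinP.
  by move=> x _ /=; rewrite !ger0_norm ?lee_fin.
pose delta := \int[mu]_x u x.
have d0 : 0 < delta.
  rewrite lt_neqAle Rintegral_ge0// andbT; apply/negP => /eqP d0.
  apply: fM.
  have : ae_eq mu setT (EFin \o u) (cst 0%E).
    apply/ae_eq_integral_abs => //; first exact/measurable_EFinP.
    rewrite -[LHS]fineK; last by apply: integrable_fin_num => //; exact: integrable_abse.
    congr EFin; rewrite [RHS]d0; apply: eq_Rintegral => x _.
    by rewrite ger0_norm.
  apply: filterS => x /(_ Logic.I) [] ux0; rewrite leNgt; apply/negP => Mf.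
  move: ux0; rewrite /u /Num.max; case: ifPn => [|_]; lra.
have d1 : delta <= 1 by rewrite -f1; apply: le_Rintegral.
pose A := [set x | f x <= a].
have mA : measurable A.
  rewrite -[A]setTI; have := mf measurableT _ (measurable_itv `]-oo, a]).
  by congr (measurable (_ `&` _)); apply/funext => x /=; rewrite in_itv.
have iA : mu.-integrable setT (EFin \o \1_A) by exact: integrable_indic.
pose alpha := fine (mu A).
have alphaE : \int[mu]_x \1_A x = alpha by exact: Rintegral_indic.
(* Markov's inequality: [f] exceeds [a] on at most half of the space. *)
have alphaV : V / 2 <= alpha.
  have : \int[mu]_x (a - a * \1_A x) <= 1.
    rewrite -f1; apply: le_Rintegral => //.
      apply: integrable_fsub => //; first exact: finite_measure_integrable_cst.
      exact: integrable_fscale.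
    move=> x _; rewrite indicE; case: (boolP (x \in A)) => [_|].
      by rewrite mulr1 subrr.
    rewrite notin_setE mulr0 subr0 => /negP; rewrite -ltNge; exact: ltW.
  rewrite RintegralB//; last exact: integrable_fscale.
    rewrite Rintegral_cst// RintegralZl// alphaE -/V /a.
    have -> : 2 / V * V = 2 by field; rewrite gt_eqF.
    move=> h; rewrite -(ler_pM2l a0) /a.
    have -> : 2 / V * (V / 2) = 1 by field; rewrite gt_eqF.
    lra.
  exact: finite_measure_integrable_cst.
have alpha0 : 0 < alpha by apply: lt_le_trans alphaV; rewrite divr_gt0.
pose q := delta / alpha.
have q0 : 0 <= q by rewrite divr_ge0 ?ltW.
have qa : q <= a.
  rewrite /q ler_pdivrMr// (le_trans d1)//.
  have -> : 1 = a * (V / 2) by rewrite /a; field; rewrite gt_eqF.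
  by rewrite ler_pM2l.
pose g x := f x - u x + q * \1_A x.
have igA : mu.-integrable setT (EFin \o (fun x => q * \1_A x)) by exact: integrable_fscale.
have pw x : [/\ 0 <= g x <= M, `|f x - g x| <= u x + q * \1_A x &
      m * M `^ (m - 1) * u x - m * X * (q * \1_A x) <= f x `^ m - g x `^ m].
  have := @redistributed_bounds a M q (f x) (x \in A) (f0 x).
  by rewrite /g indicE; apply; rewrite ?q0//= inE.
have gB x : 0 <= g x <= M by have [] := pw x.
have mg : measurable_fun setT g.
  by apply: measurable_funD; [exact: measurable_funB|exact: measurable_funM].
have g1 : \int[mu]_x g x = 1.
  rewrite RintegralD//; last exact: integrable_fsub.
  rewrite RintegralB// RintegralZl// alphaE f1 -/delta /q.
  by field; rewrite gt_eqF.
have Bg : bounded_density mu M g by [].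
exists g => //.
have ig := bounded_integrable mu _ _ mg gB.
have g0 x : 0 <= g x by have /andP[] := gB x.
have [mgm gmB] := powR_density _ _ _ (ltW m0) mg gB.
have igm := bounded_integrable mu _ _ mgm gmB.
have entropy : m * delta * (M `^ (m - 1) - X) <=
    \int[mu]_x (f x `^ m) - \int[mu]_x (g x `^ m).
  rewrite -RintegralB//.
  apply: (@le_trans _ _ (\int[mu]_x (m * M `^ (m - 1) * u x - m * X * (q * \1_A x)))).
    rewrite RintegralB//; [|exact: integrable_fscale..].
    rewrite !RintegralZl// alphaE -/delta /q divfK ?gt_eqF//.
    lra.
  apply: le_Rintegral => //.
  - by apply: integrable_fsub => //; exact: integrable_fscale.
  - exact: integrable_fsub.
  - by move=> x _; have [] := pw x.
have [iff _] := tensor_integral mu f f iF iF f0 f0.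
have [igg _] := tensor_integral mu g g ig ig g0 g0.
have inter : `|\int[(mu \x mu)%E]_z (K z * (f z.1 * f z.2)) -
    \int[(mu \x mu)%E]_z (K z * (g z.1 * g z.2))| <= 4 * C * delta.
  rewrite -RintegralB//; [|exact: (kernel_integrable mu K C mK KC)..].
  rewrite [X in `|X|](_ : _ =
      \int[(mu \x mu)%E]_z (K z * (f z.1 * f z.2 - g z.1 * g z.2))); last first.
    by apply: eq_Rintegral => z _; rewrite mulrBr.
  apply: (le_trans (kernel_bound mu K C mK KC _ _)); first exact: integrable_fsub.
  rewrite [4 * C]mulrC -mulrA ler_wpM2l//.
  apply: le_trans (tensor_dist_integral f g (fun x => u x + q * \1_A x) iF ig _ f0 g0 _) _.
  - exact: integrable_fadd.
  - by move=> x; have [] := pw x.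
  - rewrite RintegralD// RintegralZl// alphaE -/delta /q divfK ?gt_eqF// f1 g1; lra.
have : c * (m * delta * (M `^ (m - 1) - X)) >= (2 * C + c * m) * delta.
  have -> : (2 * C + c * m) * delta = c * (m * delta * (Y - X)).
    by rewrite /Y; field; rewrite ?gt_eqF.
  rewrite ler_pM2l// ler_pM2l ?mulr_gt0// lerD2r//.
have := ler_wpM2l (ltW c0) entropy.
have : 0 < c * m * delta by rewrite mulr_gt0.
move: inter; rewrite /energy ler_norml => /andP[i1 i2].
by set P := c * (m * _ * _); lra.
Qed.

End truncation.

(** * The interaction potential *)

Section potential.
Context {R : realType} {d : nat}.

Lemma periodicz {U V : zmodType} (f : U -> V) (t : U) : periodic f t ->
  forall (k : int) x, f (x + t *~ k) = f x.
Proof.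
move=> ft [n|n] x; first exact: periodicn.
by rewrite NegzE mulrNz -[in RHS](subrK (t *~ n.+1) x) periodicn.
Qed.

(** The shift is a sum of multiples of the generators of the lattice; these are
    removed one coordinate at a time. *)
Lemma torus_periodic_lattice (L : R) (W : 'rV[R]_d -> R) (k : 'I_d -> int) x :
  torus_periodic L W -> W (x + \row_i (L * (k i)%:~R)) = W x.
Proof.
move=> perW; have -> : \row_i (L * (k i)%:~R) =
    \sum_(i < d) ((L *: delta_mx 0 i) *~ k i) :> 'rV[R]_d.
  apply/rowP => j; rewrite mxE summxE (bigD1 j)//= big1 => [|i ij].
    by rewrite scalerMzl !mxE !eqxx mulr1 addr0 mulrzr.
  by rewrite scalerMzl !mxE [j == i]eq_sym (negbTE ij) andbF mulr0.
elim: (index_enum _) x => [|i s IH] x; first by rewrite big_nil addr0.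
by rewrite big_cons addrA IH periodicz.
Qed.

(** Every point can be moved into the compact cell [[0, L]^d] by a lattice shift. *)
Lemma periodic_continuous_bounded (L : R) (W : 'rV[R]_d -> R) : 0 < L ->
  torus_periodic L W -> continuous W -> exists C, forall x, `|W x| <= C.
Proof.
move=> L0 perW cW.
pose box : set 'rV[R]_d := [set v | forall i, `[0, L]%classic (v ord0 i)].
have cbox : compact box.
  by apply: (@rV_compact R d (fun=> `[0, L]%classic)) => i; exact: segment_compact.
have box0 : box !=set0.
  by exists 0 => i; rewrite /= mxE in_itv/= lexx ltW.
have cnW : {within box, continuous (fun x => `|W x|)}.
  apply: continuous_subspaceT => x; apply: continuous_comp; first exact: cW.
  exact: norm_continuous.
have [c _ cmax] := @EVT_max_rV R d (fun x => `|W x|) box box0 cbox cnW.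
exists `|W c| => x.
rewrite -(torus_periodic_lattice L W (fun i => - Num.floor (x 0 i / L)) x perW).
apply: cmax; rewrite inE => i; rewrite /= !mxE in_itv/= mulrNz mulrN.
have := Num.Theory.floor_itv (x ord0 i / L).
rewrite ler_pdivlMr// ltr_pdivrMr// => /andP[lo hi].
rewrite subr_ge0 mulrC lo/= lerBlDr.
by apply: (le_trans (ltW hi)); rewrite intrD mulrDl mul1r addrC.
Qed.

(** Rounding every coordinate down to a multiple of [1 / (n + 1)] makes the
    composition depend on countably many values only; continuity of [W] recovers
    the function as a pointwise limit. *)
Lemma measurable_continuous_row {disp : measure_display}
    {T : measurableType disp} (W : 'rV[R]_d -> R) (phi : T -> 'rV[R]_d) :
  continuous W -> (forall i, measurable_fun setT (fun t => phi t ord0 i)) ->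
  measurable_fun setT (W \o phi).
Proof.
move=> cW mphi.
pose q n t : 'rV[int]_d := \row_i Num.floor (n.+1%:R * phi t ord0 i).
pose p n (k : 'rV[int]_d) : 'rV[R]_d := \row_i ((k ord0 i)%:~R / n.+1%:R).
apply: (@measurable_fun_cvg _ _ _ setT (fun n => W \o p n \o q n)).
  move=> n _ Y mY; rewrite setTI.
  rewrite (_ : _ @^-1` Y = \bigcup_k ((q n @^-1` [set k]) `&`
      (if `[< Y (W (p n k)) >] then setT else set0))); last first.
    apply/seteqP; split=> t /=.
      by move=> Yt; exists (q n t) => //; rewrite asboolT.
    by move=> [k _ [/= <-]]; case: ifPn => // /asboolP.
  apply: countable_bigcupT_measurable; first exact: countableP.
  move=> k; apply: measurableI; last by case: ifP.
  rewrite (_ : _ @^-1` _ = \bigcap_(i in [set: 'I_d])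
      ((fun t => phi t ord0 i) @^-1` `[(k ord0 i)%:~R / n.+1%:R,
         (k ord0 i + 1)%:~R / n.+1%:R[)).
    apply: fin_bigcap_measurable => // i _.
    by rewrite -[X in measurable X]setTI; apply: mphi.
  have fl (x : R) (z : int) : (Num.floor (n.+1%:R * x) == z) =
      (x \in `[z%:~R / n.+1%:R, (z + 1)%:~R / n.+1%:R[).
    by rewrite floor_eq ?num_real// in_itv/= ler_pdivrMr// ltr_pdivlMr// mulrC.
  apply/seteqP; split=> t /=.
    by move=> <- i _ /=; rewrite -fl !mxE.
  by move=> tk; apply/rowP => i; rewrite mxE; apply/eqP; rewrite fl; exact: tk.
move=> t _; suff c : p n (q n t) @[n --> \oo] --> phi t by exact: cvg_comp c (cW (phi t)).
apply/cvg_ballP => e e0; near=> n; split => // i j.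
rewrite (ord1 i) /ball /= !mxE.
set x := phi t ord0 j; set N : R := n.+1%:R; have N0 : 0 < N by rewrite ltr0n.
have := Num.Theory.floor_itv (N * x); rewrite intrD => /andP[lo hi].
have -> : x - (Num.floor (N * x))%:~R / N = (N * x - (Num.floor (N * x))%:~R) / N.
  by field; rewrite gt_eqF.
rewrite normrM [`|N^-1|]gtr0_norm ?invr_gt0// ger0_norm ?subr_ge0//.
apply: (@le_lt_trans _ _ N^-1).
  rewrite ler_piMl ?invr_ge0 ?(ltW N0)// lerBlDr addrC; exact: ltW.
rewrite /N; near: n; exact: (near_infty_natSinv_lt (PosNum e0)).
Unshelve. all: by end_near. Qed.

End potential.

(** * The measure of the torus *)

Section torus.
Context {R : realType}.

Lemma measurable_torus (d : nat) (L : R) : measurable (@torus R d L).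
Proof.
rewrite (_ : torus L = \bigcap_(i in [set: 'I_d])
    ((fun x : coords R d => tnth x i) @^-1` `[0, L[%classic)); last first.
  by apply/seteqP; split=> x xL i => [_|]; exact: xL.
apply: fin_bigcap_measurable => // i _.
by rewrite -[X in measurable X]setTI; apply: (measurable_tnth i) => //; exact: measurable_itv.
Qed.

Lemma side_measure_itv (L : R) (A : set (measurableTypeR R)) : 0 < L ->
  `[0, L[%classic `<=` A -> side_measure L A = L%:E.
Proof.
move=> L0 LA; rewrite /side_measure /mrestr setIC setIidl//.
by rewrite lebesgue_measure_itv/= lte_fin L0 sube0.
Qed.

(** The two masses are computed together since both satisfy the same product
    recursion in the dimension. *)
Lemma torus_measure_torus (d : nat) (L : R) : 0 < L ->
  @torus_measure R d L (torus L) = (L ^+ d)%:E /\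
  @torus_measure R d L setT = (L ^+ d)%:E.
Proof.
move=> L0; elim: d => [|d [IHt IHT]].
  by rewrite /= !diracE !mem_set//= => -[].
have E1 : @cons_point R d @^-1` torus L = `[0, L[%classic `*` torus L.
  apply/seteqP; split=> -[x y] /=.
    move=> xy; split; first by have := xy ord0.
    by move=> i; have := xy (lift ord0 i); rewrite tnthS.
  by move=> [x0 y0] i; case: (unliftP ord0 i) => [j ->|->//]; rewrite tnthS; exact: y0.
have mI : measurable (`[0, L[%classic : set (measurableTypeR R)) by exact: measurable_itv.
rewrite /= /pushforward E1 preimage_setT -setXTT !product_measure1E//; last first.
  exact: measurable_torus.
rewrite exprS EFinM; split; congr (_ * _)%E; [|exact: IHt| |exact: IHT].
  exact: side_measure_itv.
exact: side_measure_itv.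
Qed.

Lemma torus_measure_gt0 (d : nat) (L : R) : 0 < L ->
  (0 < @torus_measure R d L setT)%E.
Proof.
by move=> L0; rewrite (torus_measure_torus d L L0).2 lte_fin exprn_gt0.
Qed.

Lemma torus_measure_setC (d : nat) (L : R) : 0 < L ->
  @torus_measure R d L (~` torus L) = 0%E.
Proof.
move=> L0; have [t T] := torus_measure_torus d L L0.
have mt := measurable_torus d L.
have := measureU (@torus_measure R d L) mt (measurableC mt) (setICr _).
rewrite setUv => U.
have {U} : ((L ^+ d)%:E = (L ^+ d)%:E + @torus_measure R d L (~` torus L))%E.
  transitivity (@torus_measure R d L (torus L) + @torus_measure R d L (~` torus L))%E.
    by rewrite -T; exact: U.
  by rewrite t.
have := @fin_num_measure _ _ _ (@torus_measure R d L) _ (measurableC mt).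
move=> /fineK <-; rewrite -EFinD => -[] h; congr EFin; lra.
Qed.

End torus.

(** * Probability measures and their densities *)

Local Open Scope charge_scope.

Section radon_nikodym.
Context {disp : measure_display} {T : measurableType disp} {R : realType}.
Variable mu : {finite_measure set T -> \bar R}.

(** The derivative of [rho] as a charge may be negative on a null set; the one
    built from [rho] as a measure is nonnegative everywhere. *)
Lemma nonneg_density (rho : probability T R) : rho `<< mu ->
  exists f : T -> R, [/\ (forall x, 0 <= f x),
    mu.-integrable setT (EFin \o f), \int[mu]_x f x = 1 &
    \forall x \ae mu, fine (('d (charge_of_finite_measure rho) '/d mu) x) = f x].
Proof.
move=> rhomu; pose F := Radon_Nikodym_SigmaFinite.f rho mu.
have F0 := Radon_Nikodym_SigmaFinite.f_ge0 rhomu.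
have Ffin := Radon_Nikodym_SigmaFinite.f_fin_num rhomu.
have FE : EFin \o (fine \o F) = F by apply/funext => x /=; rewrite fineK.
exists (fine \o F); split.
- by move=> x; rewrite /= fine_ge0.
- by rewrite FE; exact: Radon_Nikodym_SigmaFinite.f_integrable.
- rewrite /Rintegral; have -> : (fun x => ((fine \o F) x)%:E) = F := FE.
  rewrite -Radon_Nikodym_SigmaFinite.f_integral//.
  exact: (congr1 fine (probability_setT rho)).
- have := ae_eq_Radon_Nikodym_SigmaFinite rhomu measurableT.
  by apply: filterS => x /(_ I) <-.
Qed.

Lemma density_unique (rho : probability T R) (f : T -> R) :
  mu.-integrable setT (EFin \o f) ->
  (forall A, measurable A -> (rho A = \int[mu]_(x in A) (f x)%:E)%E) ->
  rho `<< mu /\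
  \forall x \ae mu, fine (('d (charge_of_finite_measure rho) '/d mu) x) = f x.
Proof.
move=> iF rhoE.
have mf : measurable_fun setT (EFin \o f) := measurable_int _ iF.
have rhomu : rho `<< mu.
  apply/null_content_dominatesP => A mA A0; rewrite rhoE//.
  by apply: null_set_integral => //; exact: measurable_funTS.
split => //.
have : ae_eq mu setT ('d (charge_of_finite_measure rho) '/d mu) (EFin \o f).
  apply: integral_ae_eq => //; first exact: Radon_Nikodym_integrable.
  move=> A _ mA.
  by rewrite -Radon_Nikodym_integral// -rhoE.
by apply: filterS => x /(_ I) ->.
Qed.

Lemma probability_of_density (f : T -> R) : (forall x, 0 <= f x) ->
  mu.-integrable setT (EFin \o f) -> \int[mu]_x f x = 1 ->
  exists rho : probability T R,
    forall A, measurable A -> (rho A = \int[mu]_(x in A) (f x)%:E)%E.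
Proof.
move=> f0 iF f1.
have mf : measurable_fun setT f by apply/measurable_EFinP; exact: measurable_int iF.
have [nu nuE] := density_measure mu f mf f0.
have nu1 : nu setT = 1%E.
  by rewrite nuE -f1 /Rintegral fineK//; exact: integrable_fin_num.
case: nu nuE nu1 => nu cnu nuE nu1.
pose nuM : {measure set T -> \bar R} := HB.pack nu cnu.
pose nuP := Measure_isProbability.Build _ _ _ (nuM : set _ -> _) nu1.
exists (HB.pack_for (probability T R) (Measure.sort nuM) (Measure.class nuM) nuP).
by move=> A _; exact: nuE.
Qed.

End radon_nikodym.

Section torus_energy.
Context {R : realType} {d : nat}.
Variables (L beta m : R) (W : 'rV[R]_d -> R).
Hypotheses (L0 : 0 < L) (m1 : 1 < m).

Local Notation mu := (@torus_measure R d L).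
Implicit Type rho : probability (coords R d) R.

Let K (z : coords R d * coords R d) := W (to_row z.1 - to_row z.2).
Let c := beta^-1 / (m - 1).
Variable (C : R).
Hypotheses (mK : measurable_fun setT K) (KC : forall z, `|K z| <= C).

Lemma Linfty_norm_le rho (f : coords R d -> R) (B : R) : rho `<< mu ->
  (\forall x \ae mu, density L rho x = f x) -> (forall x, 0 <= f x) ->
  ((Linfty_norm L rho <= B%:E)%E <-> (\forall x \ae mu, f x <= B)).
Proof.
move=> rhomu rhof f0; rewrite /Linfty_norm asboolT// unlock torus_measure_gt0//.
split=> [/ess_supP fB|fB].
  by apply: filterS2 rhof fB => x /= ->; rewrite ger0_norm.
apply/ess_supP; apply: filterS2 rhof fB => x /= ->.
by rewrite ger0_norm// lee_fin.
Qed.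

(** Nothing in the free energy changes when the density is modified on a null
    set.  The interaction integral converges for any density because the kernel
    is bounded, so finiteness of the energy rests on the power [f^m] alone. *)
Lemma free_energy_of_density rho (f : coords R d -> R) : rho `<< mu ->
  (\forall x \ae mu, density L rho x = f x) -> (forall x, 0 <= f x) ->
  mu.-integrable setT (EFin \o f) ->
  (finite_energy L rho m W <-> mu.-integrable setT (EFin \o (fun x => f x `^ m))) /\
  (finite_energy L rho m W -> free_energy L rho beta m W = (energy mu K c m f)%:E).
Proof.
move=> rhomu rhof f0 iF.
have mf : measurable_fun setT f by apply/measurable_EFinP; exact: measurable_int iF.
have mrho : measurable_fun setT (density L rho).
  have mRN : measurable_fun setT ('d (charge_of_finite_measure rho) '/d mu).
    by apply: (measurable_int mu); exact: Radon_Nikodym_integrable.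
  exact: (measurableT_comp (fine_measurable measurableT) mRN).
have [iff _] := tensor_integral mu f f iF iF f0 f0.
have iKff := kernel_integrable mu K C mK KC _ iff.
have pm : measurable_fun setT (fun x => density L rho x `^ m).
  exact: (measurableT_comp (measurable_powR m) mrho).
have fm : measurable_fun setT (fun x => f x `^ m).
  exact: (measurableT_comp (measurable_powR m) mf).
have pmE : ae_eq mu setT (EFin \o (fun x => density L rho x `^ m))
    (EFin \o (fun x => f x `^ m)).
  by apply: filterS rhof => x /= ->.
have mi : measurable_fun setT (interaction L rho W).
  rewrite (_ : interaction L rho W =
      fun z => K z * (density L rho z.1 * density L rho z.2)).
    by apply: measurable_funM => //; exact: measurable_tensor.
  by apply/funext => z; rewrite /interaction mulrA.
have iE : ae_eq (mu \x mu)%E setT (EFin \o interaction L rho W)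
    (EFin \o (fun z => K z * (f z.1 * f z.2))).
  have := ae_product mu _ rhof; apply: filterS => z [z1 z2] _ /=.
  by rewrite /interaction z1 z2 mulrA.
have mKff : measurable_fun setT (EFin \o (fun z => K z * (f z.1 * f z.2))).
  exact: measurable_int iKff.
split.
  split=> [[_ ip _]|ip].
    by apply: integrable_ae_eq pmE ip; exact/measurable_EFinP.
  split => //.
    by apply: integrable_ae_eq (ae_eq_sym pmE) ip; exact/measurable_EFinP.
  by apply: integrable_ae_eq (ae_eq_sym iE) iKff; exact/measurable_EFinP.
move=> fin; rewrite /free_energy asboolT// /energy.
congr (EFin (_ * _ - _ + _ * _)).
  by congr fine; apply: ae_eq_integral pmE => //; exact/measurable_EFinP.
by congr fine; apply: ae_eq_integral iE => //; exact/measurable_EFinP.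
Qed.

(** Capping a nonnegative density at [B] changes it on a null set only. *)
Lemma bounded_density_of_Linfty_norm rho (B : R) : 0 <= B ->
  (Linfty_norm L rho <= B%:E)%E ->
  exists2 f, bounded_density mu B f &
    free_energy L rho beta m W = (energy mu K c m f)%:E.
Proof.
move=> B0 rhoB.
have rhomu : rho `<< mu.
  by apply: contrapT => nmu; move: rhoB; rewrite /Linfty_norm asboolF.
have [g [g0 ig g1 rhog]] := nonneg_density mu rho rhomu.
have gB := (Linfty_norm_le _ _ _ rhomu rhog g0).1 rhoB.
have mg : measurable_fun setT g by apply/measurable_EFinP; exact: measurable_int ig.
pose f x := Num.min (g x) B.
have mf : measurable_fun setT f by exact: measurable_minr.
have fg : \forall x \ae mu, f x = g x by apply: filterS gB => x; exact: min_l.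
have fB x : 0 <= f x <= B by rewrite /f le_min g0 B0 ge_min lexx orbT.
have f0 x : 0 <= f x by have /andP[] := fB x.
have f1 : \int[mu]_x f x = 1.
  rewrite -g1; congr fine; apply: ae_eq_integral => //; try exact/measurable_EFinP.
  by apply: filterS fg => x ->.
have rhof : \forall x \ae mu, density L rho x = f x.
  by apply: filterS2 rhog fg => x <- ->.
have [fmm fmB] := powR_density _ _ _ (ltW (lt_trans ltr01 m1)) mf fB.
have iF := bounded_integrable mu _ _ mf fB.
have [finE eE] := free_energy_of_density _ _ rhomu rhof f0 iF.
by exists f => //; apply/eE/finE; exact: bounded_integrable fmm fmB.
Qed.

Lemma probability_of_bounded_density (B : R) (f : coords R d -> R) :
  bounded_density mu B f ->
  exists rho, [/\ on_torus L rho, (Linfty_norm L rho <= B%:E)%E &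
    free_energy L rho beta m W = (energy mu K c m f)%:E].
Proof.
move=> [mf fB f1]; have f0 x : 0 <= f x by have /andP[] := fB x.
have iF := bounded_integrable mu _ _ mf fB.
have [rho rhoE] := probability_of_density mu f f0 iF f1.
have [rhomu rhof] := density_unique mu rho f iF rhoE.
exists rho; split.
- have rho0 : rho (~` torus L) = 0%E.
    have /null_content_dominatesP := rhomu; apply; last exact: torus_measure_setC.
    by apply: measurableC; exact: measurable_torus.
  have := probability_setC rho (measurable_torus d L).
  rewrite [LHS]rho0 /on_torus => h.
  have := @fin_num_measure _ _ _ rho _ (measurable_torus d L).
  by move: h; case: (rho (torus L)) => //= r [] ? _; congr EFin; lra.
- apply/(Linfty_norm_le _ _ _ rhomu rhof f0).
  by apply: nearW => x; have /andP[] := fB x.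
- have [fmm fmB] := powR_density _ _ _ (ltW (lt_trans ltr01 m1)) mf fB.
  have [finE eE] := free_energy_of_density _ _ rhomu rhof f0 iF.
  by apply/eE/finE; exact: bounded_integrable fmm fmB.
Qed.

End torus_energy.

(** * Existence of a bounded minimiser *)

Theorem theorem5p3 (R : realType) (d : nat) (L : R) (W : 'rV[R]_d -> R)
    (beta m : R)
    (hd : (0 < d)%N) (hL : 0 < L)
    (hWper : torus_periodic L W) (hWC2 : C2 W)
    (hWeven : coordinate_even W) (hWmean : mean_zero L W)
    (hbeta : 0 < beta) (hm : 1 < m) :
  (exists B : R, 0 < B /\ Linfty_reducing L beta m W B) /\
  (forall B : R, 0 < B -> Linfty_reducing L beta m W B ->
     exists rho : probability (coords R d) R,
       [/\ on_torus L rho,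
           (Linfty_norm L rho < +oo)%E,
           (forall nu : probability (coords R d) R, on_torus L nu ->
              (free_energy L rho beta m W <= free_energy L nu beta m W)%E) &
           (Linfty_norm L rho <= B%:E)%E]).
Proof.
have cW : continuous W := hWC2.1.
have [C WC] := periodic_continuous_bounded L W hL hWper cW.
pose K (z : coords R d * coords R d) := W (to_row z.1 - to_row z.2).
have KC z : `|K z| <= C by exact: WC.
have mK : measurable_fun setT K.
  apply: (measurable_continuous_row W (fun z => to_row z.1 - to_row z.2)) => //.
  move=> i; under eq_fun do rewrite !mxE; apply: measurable_funB.
    exact: (measurableT_comp (measurable_tnth i) measurable_fst).
  exact: (measurableT_comp (measurable_tnth i) measurable_snd).
pose c := beta^-1 / (m - 1).
have c0 : 0 < c by rewrite divr_gt0 ?invr_gt0// subr_gt0.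
pose mu : {finite_measure set (coords R d) -> \bar R} := @torus_measure R d L.
have repr := probability_of_bounded_density L beta m W hL hm C mK KC.
have bound := bounded_density_of_Linfty_norm L beta m W hL hm C mK KC.
have [M [M0 [u Mu] trunc]] := truncation_lowers_energy mu K C c m mK KC c0 hm
  (torus_measure_gt0 d L hL).
split.
  (* Truncation handles finite energy; infinite energy exceeds that of any
     bounded density. *)
  exists M; split => // rho _ Mrho.
  have [fin|nfin] := pselect (finite_energy L rho m W); last first.
    have [rho' [t' n' e']] := repr M u Mu.
    by exists rho'; rewrite e' /free_energy (asboolF nfin) ltry.
  have [rhomu _ _] := fin.
  have [f [f0 iF f1 rhof]] := nonneg_density mu rho rhomu.
  have [finE eE] := free_energy_of_density L beta m W C mK KC rho f rhomu rhof f0 iF.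
  have [|g Mg gf] := trunc f iF f0 f1 (finE.1 fin).
    move=> /(Linfty_norm_le L hL rho f M rhomu rhof f0).2.
    by rewrite leNgt Mrho.
  have [rho' [t' n' e']] := repr M g Mg.
  by exists rho'; split => //; rewrite e' (eE fin) lte_fin.
move=> B B0 redB.
(* The reducing property itself provides a density below [B], which may be
   smaller than the truncation level [M]. *)
have [u' Bu] : bounded_density mu B !=set0.
  have [rho0 [t0 _ _]] := repr M u Mu.
  have [nB|Bn] := leP (Linfty_norm L rho0) B%:E.
    by have [f Bf _] := bound rho0 B (ltW B0) nB; exists f.
  have [rho' [_ nB _]] := redB _ t0 Bn.
  by have [f Bf _] := bound rho' B (ltW B0) nB; exists f.
have [f Bf fmin] := energy_minimiser mu K C c m mK KC (ltW c0) hm B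
  (ex_intro _ u' Bu).
have [rho [t n e]] := repr B f Bf.
exists rho; split => //; first exact: le_lt_trans n (ltry _).
have small nu : (Linfty_norm L nu <= B%:E)%E ->
    (free_energy L rho beta m W <= free_energy L nu beta m W)%E.
  move=> nB; have [g Bg eg] := bound nu B (ltW B0) nB.
  by rewrite e eg lee_fin; exact: fmin.
move=> nu tnu; have [nB|Bn] := leP (Linfty_norm L nu) B%:E; first exact: small.
have [nu' [_ nB lt']] := redB _ tnu Bn.
exact: le_trans (small _ nB) (ltW lt').
Qed.
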